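(* Let $-1<\alpha<\infty$. Let $\lambda_\alpha$ be the constant in the inequality $$\int_0^1|F(\zeta x)|^2(1-x)^{1+\alpha}\,dx\le\lambda_\alpha\|F\|_{A^2_\alpha}^2\qquad\text{for all }F\in A^2_\alpha,\ |\zeta|=1.$$ Then for every $f\in a^2_\alpha$ with $f(0)=0$ and every $\zeta\in\partial\mathbb{D}$, $$\int_0^1|f(x\zeta)|^2(1-x)^{\alpha+1}\,dx\le 2\lambda_\alpha\|f\|_{a^2_\alpha}^2.$$
   Context: $\mathbb{D}=\{z\in\mathbb{C}:|z|<1\}$. $dA(z)=\frac1\pi\,dx\,dy$ is normalized area measure, and for $\alpha>-1$, $dA_\alpha(z)=(\alpha+1)(1-|z|^2)^\alpha\,dA(z)$. $A^2_\alpha$ (resp. $a^2_\alpha$) is the space of analytic (resp. complex-valued harmonic) functions $f$ on $\mathbb{D}$ with $\left(\int_{\mathbb{D}}|f(z)|^2\,dA_\alpha(z)\right)^{1/2}<\infty$; this quantity is the norm $\|f\|_{A^2_\alpha}$ (resp. $\|f\|_{a^2_\alpha}$). By a known theorem of Andreev, a finite constant $\lambda_\alpha$ for the displayed analytic inequality exists, with $\lambda_\alpha\le\pi^{-\alpha}$ if $-1<\alpha\le0$ and $\lambda_\alpha\le\frac1{1+\alpha}$ if $\alpha\ge0$. *)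

(* Defs.v *)
From mathcomp Require Import all_boot all_order all_algebra.
From mathcomp Require Import all_classical all_reals all_analysis.
From mathcomp Require Export complex.

Set Implicit Arguments.
Unset Strict Implicit.
Unset Printing Implicit Defensive.

Import Order.TTheory GRing.Theory Num.Theory.
Import numFieldNormedType.Exports.

Local Open Scope classical_set_scope.
Local Open Scope complex_scope.
Local Open Scope ring_scope.

(* The modulus as an element of R: in R[i] itself, [`|z|] has type R[i]. *)
Definition cabs (R : realType) (z : R[i]) : R := ComplexField.Normc.normc z.

Definition disk (R : realType) : set R[i] := [set z | cabs z < 1].

(* Complex differentiability: the increments of [derivable] range over the
   scalar field R[i], seen as a normed module over itself. *)
Definition analytic_on_disk (R : realType) (F : R[i] -> R[i]) : Prop :=
  forall z, disk z -> derivable (F : R[i]^o -> R[i]^o) z 1.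

(* Functions on the disk are total functions on R[i] whose values outside the
   disk are never used.  Harmonic means twice continuously differentiable in the
   real coordinates, with vanishing Laplacian. *)
Section harmonic.
Context {R : realType}.

Definition rdisk : set (R * R) := [set p | disk (p.1 +i* p.2)].

Definition Dx (u : R * R -> R) : R * R -> R := 'D_(1, 0) u.
Definition Dy (u : R * R -> R) : R * R -> R := 'D_(0, 1) u.

Definition has_partials (u : R * R -> R) (p : R * R) : Prop :=
  derivable u p (1, 0) /\ derivable u p (0, 1).

Definition continuously_differentiable (u : R * R -> R) : Prop :=
  forall p, rdisk p ->
    [/\ has_partials u p, {for p, continuous (Dx u)}
      & {for p, continuous (Dy u)}].

Definition real_harmonic (u : R * R -> R) : Prop :=
  [/\ continuously_differentiable u,
      continuously_differentiable (Dx u),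
      continuously_differentiable (Dy u)
    & forall p, rdisk p -> Dx (Dx u) p + Dy (Dy u) p = 0].

End harmonic.

Definition harmonic_on_disk (R : realType) (f : R[i] -> R[i]) : Prop :=
  real_harmonic (fun p => complex.Re (f (p.1 +i* p.2))) /\
  real_harmonic (fun p => complex.Im (f (p.1 +i* p.2))).

Local Open Scope ereal_scope.

(* dA_alpha = (alpha + 1) (1 - |z|^2)^alpha dx dy / pi; the value is +oo when
   the integral of the nonnegative function g diverges. *)
Definition int_dA_alpha (R : realType) (alpha : R) (g : R[i] -> R) : \bar R :=
  \int[(@lebesgue_measure R \x @lebesgue_measure R)]_(p in rdisk)
    (g (p.1 +i* p.2)%C
     * ((alpha + 1) * (1 - cabs (p.1 +i* p.2)%C ^+ 2) `^ alpha / pi))%:E.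

Definition bergman_norm (R : realType) (alpha : R) (f : R[i] -> R[i]) : \bar R :=
  int_dA_alpha alpha (fun z => cabs (f z) ^+ 2)%R `^ 2^-1.

Definition in_A2 (R : realType) (alpha : R) (F : R[i] -> R[i]) : Prop :=
  analytic_on_disk F /\ bergman_norm alpha F < +oo.

Definition in_a2 (R : realType) (alpha : R) (f : R[i] -> R[i]) : Prop :=
  harmonic_on_disk f /\ bergman_norm alpha f < +oo.

Definition radial_int (R : realType) (alpha : R) (f : R[i] -> R[i]) (zeta : R[i])
    : \bar R :=
  \int[@lebesgue_measure R]_(x in `[0%R, 1%R[)
    (cabs (f (zeta * x%:C)%R) ^+ 2 * (1 - x) `^ (1 + alpha))%:E.

(* Main.v *)
Require Import Defs.
From mathcomp Require Import all_boot all_order all_algebra.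
From mathcomp Require Import all_classical all_reals all_analysis.
From mathcomp Require Import measurable_realfun ring lra.

Set Implicit Arguments.
Unset Strict Implicit.
Unset Printing Implicit Defensive.

Import Order.TTheory GRing.Theory Num.Theory.
Import numFieldNormedType.Exports.

Local Open Scope classical_set_scope.
Local Open Scope complex_scope.
Local Open Scope ring_scope.

(** Write f = u1 + i u2 with u1, u2 real harmonic and vanishing at 0.  Both sides
    of the inequality are additive over the real and imaginary parts of f,
    because |f|^2 = u1^2 + u2^2, so it suffices to treat one real harmonic u.

    On the disk u is the real part of an analytic function U = u + i v with
    v(0) = 0 ([harmonic_conjugate], [cauchy_riemann_analytic]).  Since
    |u| <= |U|, the analytic inequality applied to U bounds the radial integral
    of u^2 by lambda times the squared norm of U.  The squared norm of U is
    exactly twice that of u, because the integrals of u^2 and v^2 against a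
    radial weight agree ([weighted_sqint_conjugate]): their difference is the
    integral of Re U^2, whose value at 0 is 0.  This is where f(0) = 0 enters, and
    where the factor 2 comes from.

    The vanishing of the weighted integral of Re U^2 is the mean value property;
    it is obtained without polar coordinates
    ([integral_weighted_square_diff]).  On the disk |z|^2 < r with r < 1, let W be
    the primitive of the weight w that vanishes at r.  Then psi = U^2 / z is
    analytic, as U(0) = 0, and
      w(|z|^2) U^2 = d/d(conj z) (psi W(|z|^2)),
    that is, with psi = a + i b,
      2 w (u^2 - v^2) = d/dx (a W) - d/dy (b W).
    As W vanishes on the circle, each term integrates to 0 over every chord
    parallel to its axis, hence over the disk by Fubini's theorem.  Letting r tend
    to 1 by monotone convergence equates the two integrals over the unit disk,
    whether or not they are finite; this also shows that U has finite norm.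

    The conjugate is v(z) = Im (z * int_0^1 U'(t z) dt) with U' = u_x - i u_y,
    differentiated under the integral sign; the Laplace equation turns the
    result into an exact t-derivative. *)

(** * First-order calculus on the disk *)

Section first_order.
Context {R : realType}.
Implicit Types (e d h x y t : R) (p q : R * R) (u ux uy g : R * R -> R).

(** The additive form, without difference quotients, covers the increment 0 and
    can be combined directly with estimates in two variables. *)
Lemma is_derive1P (f : R -> R) (x l : R) :
  is_derive x 1 f l <->
  forall e, 0 < e -> exists2 d : R, 0 < d &
    forall h, `|h| < d -> `|f (x + h) - f x - l * h| <= e * `|h|.
Proof.
have key : (h^-1 *: (f (h *: (1:R) + x) - f x) @[h --> 0^'] --> l) <->
  forall e, 0 < e -> exists2 d : R, 0 < d &
    forall h, `|h| < d -> `|f (x + h) - f x - l * h| <= e * `|h|.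
  split.
    move/cvgrPdist_le => H e e0; have := H e e0.
    rewrite near_withinE => /nbhs_ballP[d /= d0 Hd]; exists d => // h hd.
    have [->|h0] := eqVneq h 0; first by rewrite addr0 mulr0 !subrr normr0 mulr0.
    have := Hd h; rewrite /ball /= sub0r normrN => /(_ hd h0).
    rewrite scaler1 -[_ *: _]/(_ * _) => Hh.
    have -> : f (x + h) - f x - l * h = - ((l - h^-1 * (f (h + x) - f x)) * h).
      by rewrite (addrC h x); field.
    by rewrite normrN normrM ler_wpM2r.
  move=> H; apply/cvgrPdist_le => e e0.
  have [d d0 Hd] := H e e0.
  rewrite near_withinE; apply/nbhs_ballP; exists d => //= h.
  rewrite /ball /= sub0r normrN => hd h0.
  rewrite scaler1 -[_ *: _]/(_ * _).
  have -> : l - h^-1 * (f (h + x) - f x) = - ((f (x + h) - f x - l * h) / h).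
    by rewrite (addrC h x); field.
  by rewrite normrN normrM normfV ler_pdivrMr ?normr_gt0// Hd.
split.
  by move=> [dv dl]; apply: (proj1 key); rewrite -dl; exact: dv.
move=> /(proj2 key) H.
have dv : derivable f x 1 by apply/cvg_ex; exists l; exact: H.
by split => //; exact: cvg_lim.
Qed.

Lemma continuous_pairP g p :
  {for p, continuous g} <->
  forall e, 0 < e -> exists2 d : R, 0 < d &
    forall q, `|q.1 - p.1| < d -> `|q.2 - p.2| < d -> `|g q - g p| <= e.
Proof.
split.
  move/cvgrPdist_le => H e e0.
  have /nbhs_ballP[d /= d0 Hd] := H e e0; exists d => // q q1 q2.
  by rewrite distrC; apply: Hd; split; rewrite /ball /= distrC.
move=> H; apply/cvgrPdist_le => e e0.
have [d d0 Hd] := H e e0; apply/(@nbhs_ballP _ (R * R)%type).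
exists d => //= q [q1 q2].
by rewrite distrC; apply: Hd; rewrite distrC.
Qed.

Lemma rdiskE p : rdisk p = (p.1 ^+ 2 + p.2 ^+ 2 < 1) :> Prop.
Proof.
rewrite /rdisk/= /disk/= /cabs/=; apply/propext; split.
  move=> H; rewrite -(@sqr_sqrtr _ (_ + _)) ?addr_ge0 ?sqr_ge0//.
  by rewrite expr_lt1// sqrtr_ge0.
move=> H; rewrite -sqrtr1 ltr_sqrt//.
Qed.

Lemma continuous_sqnorm : continuous (fun p : R * R => p.1 ^+ 2 + p.2 ^+ 2).
Proof.
move=> p; apply: cvgD; rewrite expr2; apply: cvgM;
  first [exact: cvg_fst | exact: cvg_snd].
Qed.

Lemma open_subdisk (r : R) : open [set p : R * R | p.1 ^+ 2 + p.2 ^+ 2 < r].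
Proof.
have -> : [set p : R * R | p.1 ^+ 2 + p.2 ^+ 2 < r] =
  (fun p : R * R => p.1 ^+ 2 + p.2 ^+ 2) @^-1` [set x | x < r] by [].
by apply: open_comp => [p _|]; [exact: continuous_sqnorm|exact: open_lt].
Qed.

Lemma rdisk_box p : rdisk p -> exists2 d : R, 0 < d &
  forall q, `|q.1 - p.1| < d -> `|q.2 - p.2| < d -> rdisk q.
Proof.
rewrite rdiskE => pd.
have : nbhs p [set p : R * R | p.1 ^+ 2 + p.2 ^+ 2 < 1].
  by apply: open_nbhs_nbhs; split => //; exact: open_subdisk.
move=> /nbhs_ballP[d /= d0 Hd]; exists d => // q q1 q2.
by rewrite rdiskE; apply: Hd; split; rewrite /ball/= distrC.
Qed.

Lemma rdisk_scale (t : R) p : 0 <= t <= 1 -> rdisk p -> rdisk (t * p.1, t * p.2).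
Proof.
rewrite !rdiskE/= => /andP[t0 t1].
have : 0 <= t ^+ 2 <= 1 by rewrite sqr_ge0 expr_le1.
rewrite !exprMn -mulrDr => /andP[a0 a1]; apply: le_lt_trans.
by rewrite ler_piMl// addr_ge0 ?sqr_ge0.
Qed.

(** Increments of the coordinates have either sign, hence no order on the endpoints. *)
Lemma mean_value (f df : R -> R) (a b : R) :
  (forall x, `|x - a| <= `|b - a| -> is_derive x 1 f (df x)) ->
  exists2 c : R, `|c - a| <= `|b - a| & f b - f a = df c * (b - a).
Proof.
move=> H.
have cont x y : (forall z, z \in `[x, y] -> `|z - a| <= `|b - a|) ->
    {within `[x, y], continuous f}.
  move=> xy; apply: derivable_within_continuous => z /xy /H [] //.
have [ab|/ltW ba] := leP a b.
  have I z : z \in `[a, b] -> `|z - a| <= `|b - a|.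
    by rewrite in_itv/= => /andP[az zb]; rewrite !ger0_norm ?subr_ge0// lerD2r.
  have [|c /I cI ->] := @MVT_segment _ f df a b ab _ (cont a b I).
    by move=> x /subset_itv_oo_cc/I; exact: H.
  by exists c.
have I z : z \in `[b, a] -> `|z - a| <= `|b - a|.
  rewrite in_itv/= => /andP[az zb]; rewrite !ler0_norm ?subr_le0//.
  by rewrite lerN2 lerD2r.
have [|c /I cI E] := @MVT_segment _ f df b a ba _ (cont b a I).
  by move=> x /subset_itv_oo_cc/I; exact: H.
by exists c => //; rewrite -opprB E -mulrN opprB.
Qed.

(** The partial derivatives are data, given as one-variable derivatives along
    horizontal and vertical slices, so that mean value arguments and the fundamental
    theorem of calculus apply to them without passing through ['D_v]. *)
Definition C1_on_disk u ux uy := forall p, rdisk p ->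
  [/\ is_derive p.1 1 (fun s => u (s, p.2)) (ux p),
      is_derive p.2 1 (fun s => u (p.1, s)) (uy p),
      {for p, continuous ux} & {for p, continuous uy}].

(** Continuous partial derivatives give a total first-order expansion: go from p
    to q along one horizontal and one vertical segment and apply the mean value
    theorem to each. *)
Lemma C1_expansion u ux uy p : C1_on_disk u ux uy -> rdisk p ->
  forall e, 0 < e -> exists2 d : R, 0 < d &
    forall q, `|q.1 - p.1| < d -> `|q.2 - p.2| < d ->
    `|u q - u p - ux p * (q.1 - p.1) - uy p * (q.2 - p.2)|
      <= e * (`|q.1 - p.1| + `|q.2 - p.2|).
Proof.
move=> C1 pD e e0.
have [_ _ /continuous_pairP/(_ _ e0)[d1 d10 H1]
  /continuous_pairP/(_ _ e0)[d2 d20 H2]] := C1 p pD.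
have [d3 d30 H3] := rdisk_box pD.
exists (Num.min d1 (Num.min d2 d3)); first by rewrite !lt_min d10 d20.
move=> q; rewrite !lt_min => /and3P[q11 q12 q13] /and3P[q21 q22 q23].
have box x y : `|x - p.1| <= `|q.1 - p.1| -> `|y - p.2| <= `|q.2 - p.2| ->
    rdisk (x, y).
  by move=> xp yp; apply: H3 => /=; [exact: le_lt_trans q13|exact: le_lt_trans q23].
(* Horizontal, then vertical segment of the path from q to p. *)
have [x|c1 c1q E1] := @mean_value (fun s => u (s, q.2)) (fun s => ux (s, q.2)) p.1 q.1.
  by move=> xq; have [] := C1 (x, q.2) (box _ _ xq (lexx _)).
have [x|c2 c2q E2] := @mean_value (fun s => u (p.1, s)) (fun s => uy (p.1, s)) p.2 q.2.
  move=> xq; have [] // := C1 (p.1, x).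
  by apply: box => //; rewrite subrr normr0.
rewrite -!surjective_pairing in E1 E2.
have -> : u q - u p - ux p * (q.1 - p.1) - uy p * (q.2 - p.2) =
  (ux (c1, q.2) - ux p) * (q.1 - p.1) + (uy (p.1, c2) - uy p) * (q.2 - p.2).
  move: E1 E2; set A := ux (c1, _); set B := uy (_, c2) => E1 E2.
  by rewrite !mulrBl -E1 -E2; ring.
rewrite (le_trans (ler_normD _ _))// !normrM mulrDr.
apply: lerD; apply: ler_wpM2r => //.
  by apply: H1 => //=; exact: le_lt_trans q11.
by apply: H2 => /=; [rewrite subrr normr0|exact: le_lt_trans q22].
Qed.

Lemma C1_continuous u ux uy p : C1_on_disk u ux uy -> rdisk p ->
  {for p, continuous u}.
Proof.
move=> C1 pD; apply/continuous_pairP => e e0.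
have [d d0 Hd] := C1_expansion C1 pD ltr01.
set M := (1 + `|ux p| + (1 + `|uy p|)).
have M0 : 0 < M by rewrite /M; have := normr_ge0 (ux p); have := normr_ge0 (uy p); lra.
exists (Num.min d (e / M)); first by rewrite lt_min d0 divr_gt0.
move=> q; rewrite !lt_min => /andP[q1 q1e] /andP[q2 q2e].
have := Hd q q1 q2; rewrite mul1r => Hq.
have -> : u q - u p = (u q - u p - ux p * (q.1 - p.1) - uy p * (q.2 - p.2)) +
   (ux p * (q.1 - p.1) + uy p * (q.2 - p.2)) by ring.
have eM : (e / M) * M = e by rewrite divfK// gt_eqF.
rewrite (le_trans (ler_normD _ _))//.
rewrite (le_trans (lerD Hq (ler_normD _ _)))// !normrM.
rewrite -eM /M mulrDr !mulrDr !mulr1.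
have A1 := ler_wpM2l (normr_ge0 (ux p)) (ltW q1e).
have A2 := ler_wpM2l (normr_ge0 (uy p)) (ltW q2e).
move: A1 A2 (ltW q1e) (ltW q2e); rewrite (mulrC _ (e / M)) (mulrC _ (e / M)); lra.
Qed.

Lemma C1_ray u ux uy p (t : R) : C1_on_disk u ux uy -> rdisk (t * p.1, t * p.2) ->
  is_derive t 1 (fun s => u (s * p.1, s * p.2))
    (p.1 * ux (t * p.1, t * p.2) + p.2 * uy (t * p.1, t * p.2)).
Proof.
move=> C1 tD; apply/is_derive1P => e e0.
set M := `|p.1| + `|p.2| + 1.
have M0 : 0 < M by rewrite /M; have := normr_ge0 p.1; have := normr_ge0 p.2; lra.
have [d d0 Hd] := C1_expansion C1 tD (divr_gt0 e0 M0).
exists (d / M); first by rewrite divr_gt0.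
move=> h; rewrite ltr_pdivlMr// => hd.
have hM (x : R) : `|x| <= M -> `|(t + h) * x - t * x| < d.
  move=> xM; rewrite mulrDl addrAC subrr add0r normrM.
  by apply: le_lt_trans hd; rewrite ler_wpM2l.
have p1M : `|p.1| <= M by rewrite /M; have := normr_ge0 p.2; lra.
have p2M : `|p.2| <= M by rewrite /M; have := normr_ge0 p.1; lra.
have := Hd ((t + h) * p.1, (t + h) * p.2) (hM _ p1M) (hM _ p2M) => /=.
have E x : (t + h) * x - t * x = h * x by ring.
rewrite !E !normrM -mulrDr.
set A := ux _; set B := uy _ => H.
have -> : (p.1 * A + p.2 * B) * h = A * (h * p.1) + B * (h * p.2) by ring.
rewrite opprD addrA.
apply: (le_trans H).
rewrite -mulrA ler_wpM2l ?(ltW e0)// mulrC ler_pdivrMr// ler_wpM2l// /M.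
by lra.
Qed.

End first_order.

(** * Boundedness and measurability of continuous functions on the disk *)

Section disk_topology.
Context {R : realType}.
Implicit Types (e d h x y t r : R) (p q : R * R) (g : R * R -> R).
Notation plane := (measurableTypeR R * measurableTypeR R)%type.

(** The parameter r is the square of the radius, here and below: weights will be
    functions of the squared modulus. *)
Lemma continuous_bounded_subdisk g r : r < 1 ->
  (forall p, rdisk p -> {for p, continuous g}) ->
  exists2 M : R, 0 <= M & forall p, p.1 ^+ 2 + p.2 ^+ 2 <= r -> `|g p| <= M.
Proof.
move=> r1 cg.
set K := [set p : R * R | p.1 ^+ 2 + p.2 ^+ 2 <= r].
have KD p : K p -> rdisk p by rewrite rdiskE => Kp; exact: le_lt_trans r1.
have cK : compact K.
  have cI : compact (`[-1, 1]%classic `*` `[-1, 1]%classic : set (R * R)).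
    by apply: compact_setX; exact: segment_compact.
  apply: (subclosed_compact _ cI).
    have -> : K = (fun p : R * R => p.1 ^+ 2 + p.2 ^+ 2) @^-1` [set x | x <= r] by [].
    by apply: closed_comp => [p _|]; [exact: continuous_sqnorm|exact: closed_le].
  move=> p /KD; rewrite rdiskE => pD.
  have := sqr_ge0 p.1; have := sqr_ge0 p.2 => p1 p2.
  by split=> /=; rewrite in_itv/= -ler_norml -(@expr_le1 _ 2)// ?normr_ge0// real_normK ?num_real//; lra.
have cgK : {within K, continuous g}.
  apply: continuous_in_subspaceT => p /set_mem/KD; exact: cg.
have /compact_bounded [M [_ HM]] := continuous_compact cgK cK.
exists (`|M| + 1); first by rewrite addr_ge0.
move=> p Kp; apply: (HM (`|M| + 1)); last by exists p.
by rewrite (le_lt_trans (ler_norm M))// ltrDl.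
Qed.

(** Borel sets of the plane for the product sigma-algebra: an open set is the
    countable union of the rational boxes that it contains. *)
Lemma open_measurable_prod (A : set (R * R)) : open A ->
  measurable (A : set plane).
Proof.
move=> oA.
pose B (c : (rat * rat) * (rat * rat)) : set (R * R) :=
  ball (ratr c.1.1 : R) (ratr c.1.2) `*` ball (ratr c.2.1 : R) (ratr c.2.2).
have -> : A = \bigcup_(c in [set c | B c `<=` A]) B c.
  apply/seteqP; split=> [p Ap|p [c cA]]; last exact: cA.
  have : nbhs p A by exact: open_nbhs_nbhs.
  move=> /(@nbhs_ballP _ (R * R)%type)[d /= d0 dA].
  have sub x : exists c r : rat, (ball (ratr c : R) (ratr r) : set R) x /\
      (ball (ratr c : R) (ratr r) : set R) `<=` ball x d.
    have [|c [r /= [/set_mem xB BS]]] := @open_subball_rat R (ball x d) x (ball_open _ _).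
      by apply/mem_set; exact: ballxx.
    by exists c, r.
  have [c1 [r1 [pr1 s1]]] := sub p.1; have [c2 [r2 [pr2 s2]]] := sub p.2.
  exists ((c1, r1), (c2, r2)); last by split.
  by move=> q [/= q1 q2]; apply: dA; split; [exact: s1|exact: s2].
rewrite bigcup_mkcond; apply: countable_bigcupT_measurable => // c.
case: ifP => // _; apply: measurableX; apply: open_measurable; exact: ball_open.
Qed.

Lemma continuous_measurable_disk g :
  (forall p, rdisk p -> {for p, continuous g}) -> measurable_fun (rdisk : set plane) g.
Proof.
move=> cg; apply: (measurability _ (RGenOpens.measurableE R)).
move=> _ [_ [a [b ->] <-]]; apply: open_measurable_prod.
rewrite openE => p [pD pab].
apply: filterI.
  have [d d0 Hd] := rdisk_box pD.
  apply/(@nbhs_ballP _ (R * R)%type); exists d => //= q [q1 q2].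
  by apply: Hd; rewrite distrC.
apply: (cg p pD); apply: open_nbhs_nbhs; split => //; exact: interval_open.
Qed.

Lemma measurable_subdisk r : 
  measurable ([set p | p.1 ^+ 2 + p.2 ^+ 2 < r] : set plane).
Proof. by apply: open_measurable_prod; exact: open_subdisk. Qed.

Lemma measurable_rdisk : measurable (@rdisk R : set plane).
Proof.
have -> : @rdisk R = [set p : R * R | p.1 ^+ 2 + p.2 ^+ 2 < 1].
  by apply/funext => p; rewrite rdiskE.
exact: measurable_subdisk.
Qed.

End disk_topology.

(** * The harmonic conjugate *)

Section integrals.
Context {R : realType}.
Implicit Types (e d h s t x y r a b : R) (p q : R * R) (g u ux uy : R * R -> R).
Notation mu := (@lebesgue_measure R).

Lemma FTC2_closed (F f : R -> R) a b : a < b ->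
  (forall t, t \in `[a, b] -> is_derive t 1 F (f t)) ->
  {within `[a, b], continuous f} ->
  (\int[mu]_(t in `[a, b]) (f t)%:E = (F b - F a)%:E)%E.
Proof.
move=> ab dF cf.
have cF t : t \in `[a, b] -> {for t, continuous F}.
  by move=> /dF[dFt _]; apply: differentiable_continuous; exact/derivable1_diffP.
have aab : a \in `[a, b] by rewrite in_itv/= lexx ltW.
have bab : b \in `[a, b] by rewrite in_itv/= lexx ltW.
rewrite (@continuous_FTC2 _ f F) ?EFinB//.
  split=> [t /subset_itv_oo_cc/dF[]//||].
    exact/cvg_at_right_filter/cF.
  exact/cvg_at_left_filter/cF.
by move=> t /subset_itv_oo_cc/dF[? <-]; rewrite derive1E.
Qed.

Lemma is_derive_under_integral (f f' : R -> R -> R) x d M : 0 < d -> 0 <= M ->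
  (forall s t, `|s - x| < d -> t \in `[0, 1] -> is_derive s 1 (f ^~ t) (f' s t)) ->
  (forall s, `|s - x| < d -> {within `[0, 1], continuous (f s)}) ->
  (forall s t, `|s - x| < d -> t \in `[0, 1] -> `|f' s t| <= M) ->
  is_derive x 1 (fun s => \int[mu]_(t in `[0, 1]) f s t)
    (\int[mu]_(t in `[0, 1]) f' x t).
Proof.
move=> d0 M0 df cf fM.
have I s : `]x - d, x + d[%classic s -> `|s - x| < d.
  by rewrite /= in_itv/= ltr_distl.
have xx : `]x - d, x + d[%classic x.
  by rewrite /= in_itv/= ltrDl d0 gtrBl d0.
have m01 : measurable (`[0, 1]%classic : set R) by [].
have H1 s : `]x - d, x + d[%classic s -> mu.-integrable `[0, 1]%classic (EFin \o f s).
  move=> /I /cf; apply: continuous_compact_integrable; exact: segment_compact.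
have H2 s t : `]x - d, x + d[%classic s -> `[0, 1]%classic t -> derivable (f ^~ t) s 1.
  by move=> /I sx t01; have [] := df s t sx t01.
have H3 s t : `]x - d, x + d[%classic s -> `[0, 1]%classic t -> partial1of2 f s t = f' s t.
  by move=> /I sx t01; have [_] := df s t sx t01; rewrite partial1of2E.
have H4 : mu.-integrable `[0, 1]%classic (EFin \o cst M).
  apply: continuous_compact_integrable; first exact: segment_compact.
  by apply: continuous_subspaceT => t; exact: cvg_cst.
have H5 s t : `]x - d, x + d[%classic s -> `[0, 1]%classic t -> `|partial1of2 f s t| <= cst M t.
  by move=> sx t01; rewrite H3// fM//; exact: I.
have D := @derivable_under_integral R _ _ mu f _ m01 x _ _ xx H1 H2 (cst M) (fun=> M0) H4 H5.
have E := @differentiation_under_integral R _ _ mu f _ m01 x _ _ xx H1 H2 (cst M) (fun=> M0) H4 H5.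
apply: DeriveDef; first exact: D.
rewrite -derive1E E; apply: eq_Rintegral => t /set_mem t01.
exact: H3.
Qed.

End integrals.

Section harmonic_conjugate.
Context {R : realType}.
Implicit Types (e d h s t x y r a b : R) (p q : R * R) (g u ux uy : R * R -> R).
Notation mu := (@lebesgue_measure R).

Lemma continuous_ray g p t : (forall q, rdisk q -> {for q, continuous g}) ->
  rdisk p -> t \in `[0, 1] -> {for t, continuous (fun s => g (s * p.1, s * p.2))}.
Proof.
move=> cg pD; rewrite in_itv/= => t01.
apply: (@continuous_comp _ _ _ (fun s => (s * p.1, s * p.2)) g).
  by apply: (cvg_pair (G := nbhs (t * p.1)) (H := nbhs (t * p.2)));
    (apply: cvgM; [exact: cvg_id|exact: cvg_cst]).
exact: cg (rdisk_scale t01 pD).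
Qed.

(** The imaginary part of z * int_0^1 U'(t z) dt, where U' = ux - i uy.  The star-shaped
    path from 0 keeps the domain of integration fixed, whatever the signs of the
    coordinates. *)
Definition conjugate_integral ux uy p :=
  \int[mu]_(t in `[0, 1])
     (p.2 * ux (t * p.1, t * p.2) - p.1 * uy (t * p.1, t * p.2)).

(** By the Laplace equation, the s-derivative of the integrand at s = x is
    - d/dt (t uy(t x, t y)), so that the differentiated integral telescopes. *)
Lemma conjugate_integral_dx ux uy uxx uxy uyx uyy p :
  C1_on_disk ux uxx uxy -> C1_on_disk uy uyx uyy ->
  (forall q, rdisk q -> uxx q + uyy q = 0) -> rdisk p ->
  is_derive p.1 1 (fun s => conjugate_integral ux uy (s, p.2)) (- uy p).
Proof.
move=> Cx Cy lap pD; case: p pD => x y pD /=.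
have [d0 d00 Hd0] := rdisk_box pD.
set d := d0 / 2; have d_gt0 : 0 < d by rewrite divr_gt0.
set r := (`|x| + d) ^+ 2 + y ^+ 2.
have r1 : r < 1.
  have y0 : `|y - y| < d0 by rewrite subrr normr0.
  suff [s sx ->] : exists2 s, `|s - x| < d0 & r = s ^+ 2 + y ^+ 2.
    by move: (Hd0 (s, y) sx y0); rewrite rdiskE.
  have [x0|/ltW x0] := leP 0 x.
    exists (`|x| + d) => //.
    by rewrite (ger0_norm x0) addrAC subrr add0r gtr0_norm// /d; lra.
  exists (- (`|x| + d)); last by rewrite sqrrN.
  by rewrite (ler0_norm x0) opprD opprK addrAC subrr add0r normrN gtr0_norm// /d; lra.
(* For s within d of x, all (t s, t y) with t in [0, 1] lie in one closed disk
   inside the unit disk, which gives the domination. *)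
have sx s : `|s - x| < d -> `|s| <= `|x| + d.
  by move=> /ltW sd; have := ler_normD (s - x) x; rewrite subrK; lra.
have sr s t : `|s - x| < d -> t \in `[0, 1] -> (t * s) ^+ 2 + (t * y) ^+ 2 <= r.
  move=> /sx s1; rewrite in_itv/= => t01.
  have : 0 <= t ^+ 2 <= 1 by case/andP: t01 => ? ?; rewrite sqr_ge0 expr_le1.
  rewrite !exprMn -mulrDr => /andP[a0 a1].
  have sS : s ^+ 2 <= (`|x| + d) ^+ 2.
    rewrite -real_normK ?num_real// lerXn2r// nnegrE//.
    by rewrite addr_ge0// ltW.
  apply: (@le_trans _ _ (s ^+ 2 + y ^+ 2)); last by rewrite /r lerD2r.
  by rewrite ler_piMl// addr_ge0 ?sqr_ge0.
have srD s t : `|s - x| < d -> t \in `[0, 1] -> rdisk (t * s, t * y).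
  by move=> sd t01; rewrite rdiskE/=; exact: le_lt_trans (sr s t sd t01) r1.
have sD s : `|s - x| < d -> rdisk (s, y).
  by move=> sd; have := @srD s 1 sd; rewrite !mul1r; apply; rewrite in_itv/= lexx ler01.
have cux q (qD : rdisk q) := C1_continuous Cx qD.
have cuy q (qD : rdisk q) := C1_continuous Cy qD.
have cuxx q (qD : rdisk q) : {for q, continuous uxx} by have [] := Cx q qD.
have cuyx q (qD : rdisk q) : {for q, continuous uyx} by have [] := Cy q qD.
have cuyy q (qD : rdisk q) : {for q, continuous uyy} by have [] := Cy q qD.
have [M1 M10 HM1] := continuous_bounded_subdisk r1 cuxx.
have [M2 M20 HM2] := continuous_bounded_subdisk r1 cuy.
have [M3 M30 HM3] := continuous_bounded_subdisk r1 cuyx.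
pose f s t := y * ux (t * s, t * y) - s * uy (t * s, t * y).
pose f' s t := y * (t * uxx (t * s, t * y)) -
  (uy (t * s, t * y) + s * (t * uyx (t * s, t * y))).
have xxd : `|x - x| < d by rewrite subrr normr0.
have -> : - uy (x, y) = \int[mu]_(t in `[0, 1]) f' x t.
  suff FT : (\int[mu]_(t in `[0%R, 1%R]) (f' x t)%:E =
      ((- (1 * uy (1 * x, 1 * y))) - (- (0 * uy (0 * x, 0 * y))))%:E)%E.
    by rewrite /Rintegral FT /= !mul1r !mul0r oppr0 subr0.
  apply: (@FTC2_closed _ (fun t => - (t * uy (t * x, t * y)))); first exact: ltr01.
  - move=> t t01.
    have D := C1_ray Cy (srD x t xxd t01 : rdisk (t * (x, y).1, t * (x, y).2)).
    have Dt := is_deriveM (is_derive_id t 1) D.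
    apply: (is_derive_eq (is_deriveN Dt)).
    rewrite /f' /= -[_ *: 1]/(_ * 1) -[_ *: _]/(_ * _).
    have := lap _ (srD x t xxd t01) => L.
    have -> : uxx (t * x, t * y) = - uyy (t * x, t * y) by apply/eqP; rewrite -addr_eq0 L.
    ring.
  - apply: continuous_in_subspaceT => t /set_mem t01.
    apply: cvgB; [apply: cvgMr; apply: cvgM => //|apply: cvgD; last (apply: cvgMr; apply: cvgM => //)].
    + exact: (continuous_ray cuxx pD t01).
    + exact: (continuous_ray cuy pD t01).
    + exact: (continuous_ray cuyx pD t01).
apply: (@is_derive_under_integral _ f f' x d (`|y| * M1 + (M2 + (`|x| + d) * M3))) => //.
- by rewrite !addr_ge0 ?mulr_ge0 ?addr_ge0// ltW.
- move=> s t sd t01.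
  have tD := srD s t sd t01.
  have [dux _ _ _] := Cx _ tD; have [duy _ _ _] := Cy _ tD.
  have ts : is_derive s 1 (fun s => t * s) t.
    apply: (is_derive_eq (is_deriveM (is_derive_cst t s 1) (is_derive_id s 1))).
    by rewrite /= -![_ *: _]/(_ * _); ring.
  have d1 := is_derive1_comp dux ts; have d2 := is_derive1_comp duy ts.
  have e1 := is_deriveM (is_derive_cst y s 1) d1.
  have e2 := is_deriveM (is_derive_id s 1) d2.
  apply: (is_derive_eq (is_deriveB e1 e2)).
  rewrite /f' /= -![_ *: _]/(_ * _). 
  ring.
- move=> s sd; apply: continuous_in_subspaceT => t /set_mem t01.
  apply: cvgB; apply: cvgMr.
    exact: (continuous_ray cux (sD s sd) t01).
  exact: (continuous_ray cuy (sD s sd) t01).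
- move=> s t sd t01.
  have := HM1 _ (sr s t sd t01 : (t * s, t * y).1 ^+ 2 + (t * s, t * y).2 ^+ 2 <= r).
  have := HM2 _ (sr s t sd t01 : (t * s, t * y).1 ^+ 2 + (t * s, t * y).2 ^+ 2 <= r).
  have := HM3 _ (sr s t sd t01 : (t * s, t * y).1 ^+ 2 + (t * s, t * y).2 ^+ 2 <= r).
  rewrite /f'; set A := uyx _; set B := uy _; set C := uxx _ => hA hB hC.
  have t1 : `|t| <= 1 by move: t01; rewrite in_itv/= => /andP[? ?]; rewrite ger0_norm.
  rewrite (le_trans (ler_normB _ _))// lerD//.
    by rewrite normrM ler_wpM2l// normrM -[leRHS]mul1r ler_pM.
  rewrite (le_trans (ler_normD _ _))// lerD// normrM ler_pM//; first exact: sx.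
  by rewrite normrM -[leRHS]mul1r ler_pM.
Qed.


(** The map (x, y) -> (y, x) composed with a sign change preserves
    [conjugate_integral] up to that swap; this reduces the y-derivative of the
    conjugate to its x-derivative. *)
Lemma C1_oppswap u ux uy : C1_on_disk u ux uy ->
  C1_on_disk (fun p => - u (p.2, p.1)) (fun p => - uy (p.2, p.1))
             (fun p => - ux (p.2, p.1)).
Proof.
move=> C1 [x y] pD.
have pD' : rdisk (y, x) by move: pD; rewrite !rdiskE/= addrC.
have sw g : {for (y, x), continuous g} ->
    {for (x, y), continuous (fun p => - g (p.2, p.1))}.
  move=> /continuous_pairP cg; apply/continuous_pairP => e e0.
  have [d d0 Hd] := cg e e0; exists d => // q q1 q2.
  by rewrite -opprD normrN; apply: Hd.
have [dx dy cx cy] := C1 _ pD'.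
by split; [exact: is_deriveN dy|exact: is_deriveN dx|exact: sw|exact: sw].
Qed.

Lemma harmonic_conjugate ux uy uxx uxy uyx uyy :
  C1_on_disk ux uxx uxy -> C1_on_disk uy uyx uyy ->
  (forall q, rdisk q -> uxx q + uyy q = 0) ->
  exists2 v, v (0, 0) = 0 & C1_on_disk v (fun p => - uy p) ux.
Proof.
move=> Cx Cy lap; exists (conjugate_integral ux uy).
  rewrite /conjugate_integral /=.
  under eq_Rintegral do rewrite !mul0r subrr.
  by rewrite Rintegral_cst// mul0r.
move=> [x y] pD; have pD' : rdisk (y, x) by move: pD; rewrite !rdiskE/= addrC.
split; last 2 first.
- by apply: cvgN; exact: C1_continuous Cy pD.
- exact: C1_continuous Cx pD.
- exact: (conjugate_integral_dx Cx Cy lap pD).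
have lap' q : rdisk q -> - uyy (q.2, q.1) + - uxx (q.2, q.1) = 0.
  move=> qD; rewrite -opprD addrC lap ?oppr0//.
  by move: qD; rewrite !rdiskE/= addrC.
have := conjugate_integral_dx (C1_oppswap Cy) (C1_oppswap Cx) lap' pD'.
rewrite /= opprK; congr is_derive; apply/funext => s.
apply: eq_Rintegral => t _ /=; ring.
Qed.

End harmonic_conjugate.

Section analytic.
Context {R : realType}.
Implicit Types (u v : R * R -> R).

(** The first-order expansions of u and v are the real and imaginary parts of the
    complex one with derivative l = ux - i uy. *)
Lemma cauchy_riemann_analytic u v ux uy :
  C1_on_disk u ux uy -> C1_on_disk v (fun p => - uy p) ux ->
  analytic_on_disk (fun z : R[i] =>
    u (complex.Re z, complex.Im z) +i* v (complex.Re z, complex.Im z)).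
Proof.
move=> Cu Cv [x y] zD; set F := (X in derivable X).
have pD : rdisk (x, y) := zD.
set l := ux (x, y) -i* uy (x, y).
apply/cvg_ex; exists l.
apply/cvgrPdist_le => /= -[e ei]; rewrite ltcE/= => /andP[/eqP -> {ei} e0].
have e40 : 0 < e / 4 by rewrite divr_gt0.
have [d1 d10 H1] := C1_expansion Cu pD e40.
have [d2 d20 H2] := C1_expansion Cv pD e40.
rewrite near_withinE; apply/nbhs_ballP; exists (Num.min d1 d2)%:C => /=.
  by rewrite ltcR lt_min d10.
move=> [h1 h2]; rewrite /ball /= sub0r normrN normc_def ltcR lt_min /=.
set n := Num.sqrt _ => /andP[n1 n2] h0.
set h := h1 +i* h2.
have h1n : `|h1| <= n by rewrite /n -sqrtr_sqr ler_wsqrtr// lerDl sqr_ge0.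
have h2n : `|h2| <= n by rewrite /n -sqrtr_sqr ler_wsqrtr// lerDr sqr_ge0.
have E (s k : R) : s + k - s = k by rewrite addrAC subrr add0r.
have := H1 (x + h1, y + h2); rewrite /= !E => /(_ (le_lt_trans h1n n1) (le_lt_trans h2n n1)).
have := H2 (x + h1, y + h2); rewrite /= !E => /(_ (le_lt_trans h1n n2) (le_lt_trans h2n n2)).
set B := _ - _ * h2; set A := _ - _ * h2 => HB HA.
have hA : h%:A = h by rewrite -[h%:A]/(h * 1) mulr1.
have D : F (h%:A + (x +i* y)) - F (x +i* y) - l * h = A +i* B.
  rewrite hA /F /h /l /A /B /= [h1 + x]addrC [h2 + y]addrC; simpc.
  by congr (_ +i* _); ring.
rewrite -[_ *: _]/(_ * _).
have -> : l - h^-1 * (F (h%:A + (x +i* y)) - F (x +i* y)) = - ((A +i* B) / h).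
  by rewrite -D; field.
rewrite normrN normrM normfV ler_pdivrMr ?normr_gt0// !normc_def /= -/n.
rewrite complexr0 -rmorphM lecR.
have n0 : 0 <= n by exact: sqrtr_ge0.
have sqrt_le (a b : R) : Num.sqrt (a ^+ 2 + b ^+ 2) <= `|a| + `|b|.
  rewrite -(@ler_pXn2r _ 2)// ?nnegrE ?sqrtr_ge0 ?addr_ge0//.
  rewrite sqr_sqrtr ?addr_ge0 ?sqr_ge0// sqrrD !real_normK ?num_real// lerD2r.
  by rewrite lerDl mulrn_wge0 ?mulr_ge0.
apply: (le_trans (sqrt_le A B)); apply: (le_trans (lerD HA HB)).
have : e / 4 * (`|h1| + `|h2|) <= e / 4 * (n + n).
  by rewrite ler_wpM2l ?(ltW e40)// lerD.
lra.
Qed.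

End analytic.

(** * Divergence theorem on disks, chord by chord *)

Section chords.
Context {R : realType}.
Implicit Types (e d h s t x y r a b : R) (p q : R * R) (F K : R * R -> R).
Notation mu := (@lebesgue_measure R).
Notation mu2 := ((@lebesgue_measure R) \x (@lebesgue_measure R))%E.

(** The sublevel set is an interval centered at 0 (or empty) at whose endpoints F
    vanishes; r < 1 leaves room for F to be differentiable at the endpoints. *)
Lemma integral_chord (F K : R -> R) r c : r < 1 ->
  (forall s, s ^+ 2 + c < 1 -> is_derive s 1 F (K s)) ->
  (forall s, s ^+ 2 + c < 1 -> {for s, continuous K}) ->
  (forall s, s ^+ 2 + c = r -> F s = 0) ->
  (\int[mu]_(s in [set s | (s ^+ 2 + c < r)%R]) (K s)%:E = 0)%E.
Proof.
move=> r1 dF cK F0.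
have [rc|cr] := leP (r - c) 0.
  rewrite (_ : [set s | _] = set0) ?integral_set0//.
  rewrite -subset0 => s /= sr; have := sqr_ge0 s.
  by move: sr rc; rewrite /=; lra.
set b := Num.sqrt (r - c).
have b0 : 0 < b by rewrite sqrtr_gt0.
have b2 : b ^+ 2 = r - c by rewrite sqr_sqrtr// ltW.
have -> : [set s | s ^+ 2 + c < r] = `]- b, b[%classic.
  apply/seteqP; split => s /=; rewrite in_itv/= -ltr_norml.
    move=> sr; rewrite -(@ltr_pXn2r _ 2)// ?nnegrE ?(ltW b0)// b2.
    by rewrite real_normK ?num_real// ltrBrDr.
  move=> sb; rewrite -ltrBrDr -b2 -[ltLHS]real_normK ?num_real//.
  by rewrite ltr_pXn2r// nnegrE ltW.
have inI s : s \in `[- b, b] -> s ^+ 2 + c < 1.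
  rewrite in_itv/= -ler_norml => sb.
  have : `|s| ^+ 2 <= b ^+ 2 by rewrite ler_pXn2r// nnegrE ltW.
  rewrite b2 real_normK ?num_real//; move: r1; lra.
have cKb : {within `[- b, b], continuous K}.
  by apply: continuous_in_subspaceT => s /set_mem/inI; exact: cK.
have mK : measurable_fun (`[- b, b]%classic : set R) K.
  by apply: subspace_continuous_measurable_fun.
have mKo : measurable_fun (`]- b, b[%classic : set R) (EFin \o K).
  apply/measurable_EFinP; apply: measurable_funS mK => //.
  exact: subset_itv_oo_cc.
have mKo' : measurable_fun (`[- b, b[%classic : set R) (EFin \o K).
  apply/measurable_EFinP; apply: measurable_funS mK => //.
  exact: subset_itv_co_cc.
rewrite integral_itv_obnd_cbnd// integral_itv_bndo_bndc//.
have FT : (\int[mu]_(t in `[(- b)%R, b]) (K t)%:E = (F b - F (- b))%:E)%E.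
  apply: FTC2_closed => //; first by lra.
  by move=> s /inI; exact: dF.
by rewrite FT !F0 ?subrr// ?sqrrN b2 subrK.
Qed.

Lemma integrable_subdisk K r : r < 1 ->
  (forall p, rdisk p -> {for p, continuous K}) ->
  mu2.-integrable [set p | p.1 ^+ 2 + p.2 ^+ 2 < r] (EFin \o K).
Proof.
move=> r1 cK; have mr := @measurable_subdisk R r.
have sub : [set p : R * R | p.1 ^+ 2 + p.2 ^+ 2 < r] `<=` @rdisk R.
  by move=> p /= pr; rewrite rdiskE; exact: lt_trans r1.
apply: measurable_bounded_integrable => //.
- apply: (@le_lt_trans _ _ (mu2 (`[-1, 1]%classic `*` `[-1, 1]%classic))).
    apply: le_measure; rewrite ?inE//; first exact: measurableX.
    move=> p /sub; rewrite rdiskE => pD.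
    have := sqr_ge0 p.1; have := sqr_ge0 p.2 => p1 p2.
    by split=> /=; rewrite in_itv/= -ler_norml -(@expr_le1 _ 2)// ?normr_ge0// real_normK ?num_real//; lra.
  rewrite product_measure1E//= !lebesgue_measure_itv/=.
  by rewrite lte_fin; case: ifP => _ ; rewrite -?EFinB -?EFinM ltry.
- apply: measurable_funS (continuous_measurable_disk cK) => //.
  exact: measurable_rdisk.
- have [M M0 HM] := continuous_bounded_subdisk r1 cK.
  exists M; split; first exact: num_real.
  by move=> N MN p /= pr; apply: le_trans (ltW MN); apply: HM; exact: ltW.
Qed.

Lemma integral_subdisk_dx F K r : r < 1 ->
  (forall p, rdisk p -> is_derive p.1 1 (fun s => F (s, p.2)) (K p)) ->
  (forall p, rdisk p -> {for p, continuous K}) ->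
  (forall p, p.1 ^+ 2 + p.2 ^+ 2 = r -> F p = 0) ->
  (\int[mu2]_(p in [set p | (p.1 ^+ 2 + p.2 ^+ 2 < r)%R]) (K p)%:E = 0)%E.
Proof.
move=> r1 dF cK F0; have mr := @measurable_subdisk R r.
have iK := integrable_subdisk r1 cK.
rewrite integral_mkcond -integral21_prod_meas1; last first.
  exact: (proj1 (integrable_mkcond _ mr) iK).
apply: integral0_eq => y _; rewrite /fubini_G.
transitivity (\int[mu]_(s in [set s | (s ^+ 2 + y ^+ 2 < r)%R]) (K (s, y))%:E)%E.
  rewrite [RHS]integral_mkcond; apply: eq_integral => x _.
  by rewrite !patchE.
apply: (@integral_chord (fun s => F (s, y)) (fun s => K (s, y)) r (y ^+ 2) r1).
- by move=> s sy; apply: (dF (s, y)); rewrite rdiskE.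
- move=> s sy; apply: (@continuous_comp _ _ _ (fun s => (s, y)) K).
    by apply: (cvg_pair (G := nbhs s) (H := nbhs y)); [exact: cvg_id|exact: cvg_cst].
  by apply: cK; rewrite rdiskE.
- by move=> s sr; apply: F0.
Qed.

Lemma integral_subdisk_dy F K r : r < 1 ->
  (forall p, rdisk p -> is_derive p.2 1 (fun s => F (p.1, s)) (K p)) ->
  (forall p, rdisk p -> {for p, continuous K}) ->
  (forall p, p.1 ^+ 2 + p.2 ^+ 2 = r -> F p = 0) ->
  (\int[mu2]_(p in [set p | (p.1 ^+ 2 + p.2 ^+ 2 < r)%R]) (K p)%:E = 0)%E.
Proof.
move=> r1 dF cK F0; have mr := @measurable_subdisk R r.
have iK := integrable_subdisk r1 cK.
rewrite integral_mkcond -integral12_prod_meas1; last first.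
  exact: (proj1 (integrable_mkcond _ mr) iK).
apply: integral0_eq => x _; rewrite /fubini_F.
transitivity (\int[mu]_(s in [set s | (s ^+ 2 + x ^+ 2 < r)%R]) (K (x, s))%:E)%E.
  have -> : [set s | s ^+ 2 + x ^+ 2 < r] = [set s | x ^+ 2 + s ^+ 2 < r].
    by apply/funext => s; rewrite /mkset /= addrC.
  by rewrite [RHS]integral_mkcond; apply: eq_integral => y _; rewrite !patchE.
apply: (@integral_chord (fun s => F (x, s)) (fun s => K (x, s)) r (x ^+ 2) r1).
- by move=> s sy; apply: (dF (x, s)); rewrite rdiskE/= addrC.
- move=> s sy; apply: (@continuous_comp _ _ _ (fun s => (x, s)) K).
    by apply: (cvg_pair (G := nbhs x) (H := nbhs s)); [exact: cvg_cst|exact: cvg_id].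
  by apply: cK; rewrite rdiskE/= addrC.
- by move=> s sr; apply: F0; rewrite addrC.
Qed.

End chords.

(** * The quotient of an analytic function by its variable *)

Section quotient.
Context {R : realType}.
Implicit Types (e d h s t x y r a b : R) (p q : R * R) (u v ux uy : R * R -> R).

Lemma sqnorm_gt0 p : p != (0, 0) -> 0 < p.1 ^+ 2 + p.2 ^+ 2.
Proof.
case: p => x y; rewrite xpair_eqE negb_and /= => /orP[x0|y0].
  by rewrite ltr_pwDl ?sqr_ge0// exprn_even_gt0.
by rewrite ltr_wpDl ?sqr_ge0// exprn_even_gt0.
Qed.

(** The real part of U / z for U = u + i v, extended by Re U'(0) at 0.  The imaginary
    part is that of - i U, namely [quot_re v (- u) (- uy)]. *)
Definition quot_re u v ux p := if p == (0, 0) then ux p else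
  (u p * p.1 + v p * p.2) / (p.1 ^+ 2 + p.2 ^+ 2).

(** At 0 the Cauchy-Riemann equations cancel the first-order terms:
    u x + v y = ux(0) (x^2 + y^2) + E1 x + E2 y, with E1, E2 the remainders of the
    expansions of u and v. *)
Lemma continuous_quot_re u v ux uy p :
  C1_on_disk u ux uy -> C1_on_disk v (fun p => - uy p) ux ->
  u (0, 0) = 0 -> v (0, 0) = 0 -> rdisk p ->
  {for p, continuous (quot_re u v ux)}.
Proof.
move=> Cu Cv u0 v0 pD; have [p0|p0] := eqVneq p (0, 0).
  apply/continuous_pairP => e e0; rewrite {}p0 in pD *.
  have e2 : 0 < e / 2 by rewrite divr_gt0.
  have [d1 d10 H1] := C1_expansion Cu pD e2.
  have [d2 d20 H2] := C1_expansion Cv pD e2.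
  exists (Num.min d1 d2); first by rewrite lt_min d10.
  move=> [x y] /=; rewrite !lt_min => /andP[x1 x2] /andP[y1 y2].
  rewrite /quot_re eqxx; case: eqVneq => [->|q0].
    by rewrite subrr normr0 ltW.
  have rho := sqnorm_gt0 q0; rewrite /= in rho.
  have := H1 (x, y) x1 y1; have := H2 (x, y) x2 y2; rewrite /= u0 v0 !subr0.
  set a := ux _; set b := uy _; set U := u _; set V := v _.
  set E2 := V - _ - _; set E1 := U - _ - _ => h2 h1.
  have -> : (U * x + V * y) / (x ^+ 2 + y ^+ 2) - a =
      (E1 * x + E2 * y) / (x ^+ 2 + y ^+ 2).
    by rewrite /E1 /E2; field; exact: lt0r_neq0.
  rewrite normrM normfV (gtr0_norm rho) ler_pdivrMr//.
  rewrite (le_trans (ler_normD _ _))// !normrM.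
  rewrite (le_trans (lerD (ler_wpM2r (normr_ge0 x) h1) (ler_wpM2r (normr_ge0 y) h2)))//.
  rewrite -[x ^+ 2]real_normK ?num_real// -[y ^+ 2]real_normK ?num_real//.
  move: (`|x|) (`|y|) => X Y.
  have -> : e / 2 * (X + Y) * X + e / 2 * (X + Y) * Y = e / 2 * (X + Y) ^+ 2 by ring.
  have -> : e * (X ^+ 2 + Y ^+ 2) = e / 2 * (2 * (X ^+ 2 + Y ^+ 2)) by field.
  rewrite ler_wpM2l ?(ltW e2)//; have := sqr_ge0 (X - Y).
  by rewrite sqrrB sqrrD; lra.
set Q := fun q : R * R => (u q * q.1 + v q * q.2) / (q.1 ^+ 2 + q.2 ^+ 2).
have -> : {for p, continuous (quot_re u v ux)} = (quot_re u v ux q @[q --> p] --> Q p).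
  by rewrite /prop_for /continuous_at {2}/quot_re (negPf p0).
have rho := sqnorm_gt0 p0.
have QE : {near p, Q =1 quot_re u v ux}.
  have : \forall q \near p, 0 < q.1 ^+ 2 + q.2 ^+ 2.
    exact: (cvgr_gt (p.1 ^+ 2 + p.2 ^+ 2) (@continuous_sqnorm R p)).
  apply: filterS => q qr; rewrite /quot_re; case: eqVneq => // q0.
  by move: qr; rewrite q0 /= expr0n addr0 ltxx.
apply: cvg_trans; first exact: (near_eq_cvg QE).
apply: cvgM.
  apply: cvgD; apply: cvgM.
  - exact: C1_continuous Cu pD.
  - exact: cvg_fst.
  - exact: C1_continuous Cv pD.
  - exact: cvg_snd.
apply: cvgV; first exact: lt0r_neq0.
exact: continuous_sqnorm.
Qed.

End quotient.

(** * Orthogonality of the square to radial weights *)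

Section orthogonality.
Context {R : realType}.
Implicit Types (e d h s t x y r a b c : R) (p q : R * R) (u v ux uy : R * R -> R).
Notation mu2 := ((@lebesgue_measure R) \x (@lebesgue_measure R))%E.

Lemma C1_opp u ux uy : C1_on_disk u ux uy ->
  C1_on_disk (fun p => - u p) (fun p => - ux p) (fun p => - uy p).
Proof.
move=> C1 p pD; have [dx dy cx cy] := C1 p pD.
by split; [exact: is_deriveN dx|exact: is_deriveN dy|exact: cvgN|exact: cvgN].
Qed.

(** The real part of (U + i V)^2 / (s + i c), equal to 0 at s = c = 0 since division
    by 0 gives 0.  The imaginary part of (U + i V)^2 / (x + i y) is
    [- square_quot U V (- x) y], so both are instances with the active variable
    last. *)
Definition square_quot (U V c s : R) :=
  ((U ^+ 2 - V ^+ 2) * s + 2 * U * V * c) / (s ^+ 2 + c ^+ 2).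

Lemma is_derive_square_quot (U V : R -> R) U' V' c x : x ^+ 2 + c ^+ 2 != 0 ->
  is_derive x 1 U U' -> is_derive x 1 V V' ->
  is_derive x 1 (fun s => square_quot (U s) (V s) c s)
    ((2 * (U x * U' - V x * V') * x + (U x ^+ 2 - V x ^+ 2) +
      2 * (U' * V x + U x * V') * c) / (x ^+ 2 + c ^+ 2) -
     square_quot (U x) (V x) c x * (2 * x) / (x ^+ 2 + c ^+ 2)).
Proof.
move=> n0 dU dV.
have di := is_derive_id x 1.
have d1 := is_deriveM (is_deriveB (is_deriveM dU dU) (is_deriveM dV dV)) di.
have d2 := is_deriveM (is_deriveM (is_deriveM (is_derive_cst (2 : R) x 1) dU) dV) (is_derive_cst c x 1).
have d3 := is_deriveD (is_deriveM di di) (is_derive_cst (c ^+ 2) x 1).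
have n1 : ((id : R -> R) * id + cst (c ^+ 2)) x != 0 by [].
have d4 := is_deriveM (is_deriveD d1 d2) (is_deriveV n1 d3).
apply: (is_derive_eq d4).
rewrite /square_quot /= -![_ *: _]/(_ * _) !fctE.
field. exact: n0.
Qed.

Context (u v ux uy : R * R -> R).
Context (Cu : C1_on_disk u ux uy) (Cv : C1_on_disk v (fun p => - uy p) ux).
Context (u0 : u (0, 0) = 0) (v0 : v (0, 0) = 0).

(* With U = u + i v: U / z = P + i Q, U^2 / z = a + i b, and A is the real part of
   (U^2 / z)' = 2 U' (U / z) - (U / z)^2. *)
Let P := quot_re u v ux.
Let Q := quot_re v (fun p => - u p) (fun p => - uy p).
Let a p := square_quot (u p) (v p) p.2 p.1.
Let b p := - square_quot (u p) (v p) (- p.1) p.2.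
Let A p := 2 * (ux p * P p + uy p * Q p) - (P p ^+ 2 - Q p ^+ 2).

Let cP p : rdisk p -> {for p, continuous P}.
Proof. exact: continuous_quot_re Cu Cv u0 v0. Qed.

Let cQ p : rdisk p -> {for p, continuous Q}.
Proof.
by apply: (continuous_quot_re Cv (C1_opp Cu) v0); rewrite u0 oppr0.
Qed.

Let cA p : rdisk p -> {for p, continuous A}.
Proof.
move=> pD; have [_ _ cux cuy] := Cu pD.
apply: cvgB; last by rewrite !expr2; apply: cvgB; apply: cvgM; first [exact: cP|exact: cQ].
apply: cvgMr; apply: cvgD; apply: cvgM => //; [exact: cP|exact: cQ].
Qed.

Let aE : a = fun p => u p * P p - v p * Q p.
Proof.
apply/funext => p; rewrite /a /P /Q /square_quot /quot_re.
case: eqVneq => [->|/sqnorm_gt0/lt0r_neq0 n0]; first by rewrite u0 v0 /=; ring.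
by field.
Qed.

Let bE : b = fun p => u p * Q p + v p * P p.
Proof.
apply/funext => p; rewrite /b /P /Q /square_quot /quot_re.
case: eqVneq => [->|/sqnorm_gt0/lt0r_neq0 n0]; first by rewrite u0 v0 /=; ring.
by rewrite sqrrN [p.2 ^+ 2 + _]addrC; field.
Qed.

Let cu p : rdisk p -> {for p, continuous u}.
Proof. exact: C1_continuous Cu. Qed.

Let cv p : rdisk p -> {for p, continuous v}.
Proof. exact: C1_continuous Cv. Qed.

Let ca p : rdisk p -> {for p, continuous a}.
Proof.
move=> pD; rewrite aE; apply: cvgB; apply: cvgM;
  by [exact: cP|exact: cQ|exact: cu|exact: cv].
Qed.

Let cb p : rdisk p -> {for p, continuous b}.
Proof.
move=> pD; rewrite bE; apply: cvgD; apply: cvgM;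
  by [exact: cP|exact: cQ|exact: cu|exact: cv].
Qed.

(** Off the origin this is the quotient rule.  At the origin it is read off from
    a(s, 0) = s (P^2 - Q^2)(s, 0) and the continuity of P and Q. *)
Let da p : rdisk p -> is_derive p.1 1 (fun s => a (s, p.2)) (A p).
Proof.
move=> pD; have [p0|p0] := eqVneq p (0, 0); last first.
  have n0 := lt0r_neq0 (sqnorm_gt0 p0).
  have [dux _ _ _] := Cu pD; have [dvx _ _ _] := Cv pD.
  apply: (is_derive_eq (is_derive_square_quot n0 dux dvx)).
  rewrite -!surjective_pairing /A /P /Q /quot_re (negPf p0) /square_quot.
  by field.
rewrite p0 in pD *; apply/is_derive1_caratheodory.
exists (fun s => P (s, 0) ^+ 2 - Q (s, 0) ^+ 2); split.
- move=> z; rewrite /a /P /Q /square_quot /quot_re /=.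
  rewrite !xpair_eqE eqxx andbT u0 v0.
  case: eqVneq => [->|z0]; first by rewrite u0 v0; ring.
  by rewrite !(expr0n, mulr0, mul0r, addr0, subr0)/=; field.
- have c0 : (fun s => (s, 0)) s @[s --> (0 : R)] --> ((0 : R), (0 : R)).
    by apply: (cvg_pair (G := nbhs (0 : R)) (H := nbhs (0 : R))); [exact: cvg_id|exact: cvg_cst].
  have cP0 := continuous_comp c0 (cP pD); have cQ0 := continuous_comp c0 (cQ pD).
  by rewrite /prop_for /continuous_at !expr2; apply: cvgB; apply: cvgM; first [exact: cP0|exact: cQ0].
- by rewrite /A /P /Q /quot_re eqxx; ring.
Qed.

Let db p : rdisk p -> is_derive p.2 1 (fun s => b (p.1, s)) (A p).
Proof.
move=> pD; have [p0|p0] := eqVneq p (0, 0); last first.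
  have n0 := lt0r_neq0 (sqnorm_gt0 p0).
  have n1 : p.2 ^+ 2 + (- p.1) ^+ 2 != 0 by rewrite sqrrN addrC.
  have [_ duy _ _] := Cu pD; have [_ dvy _ _] := Cv pD.
  apply: (is_derive_eq (is_deriveN (is_derive_square_quot n1 duy dvy))).
  rewrite -!surjective_pairing /A /P /Q /quot_re (negPf p0) /square_quot.
  by rewrite sqrrN [p.2 ^+ 2 + _]addrC; field.
rewrite p0 in pD *; apply/is_derive1_caratheodory.
exists (fun s => P (0, s) ^+ 2 - Q (0, s) ^+ 2); split.
- move=> z; rewrite /b /P /Q /square_quot /quot_re /=.
  rewrite !xpair_eqE eqxx u0 v0 /=.
  case: eqVneq => [->|z0]; first by rewrite u0 v0; ring.
  by rewrite !(oppr0, expr0n, mulr0, mul0r, addr0, add0r, subr0)/=; field.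
- have c0 : (fun s => (0, s)) s @[s --> (0 : R)] --> ((0 : R), (0 : R)).
    by apply: (cvg_pair (G := nbhs (0 : R)) (H := nbhs (0 : R))); [exact: cvg_cst|exact: cvg_id].
  have cP0 := continuous_comp c0 (cP pD); have cQ0 := continuous_comp c0 (cQ pD).
  by rewrite /prop_for /continuous_at !expr2; apply: cvgB; apply: cvgM; first [exact: cP0|exact: cQ0].
- by rewrite /A /P /Q /quot_re eqxx; ring.
Qed.

Let abE p : p.1 * a p - p.2 * b p = u p ^+ 2 - v p ^+ 2.
Proof.
rewrite /a /b /square_quot; have [->|/sqnorm_gt0/lt0r_neq0 n0] := eqVneq p (0, 0).
  by rewrite u0 v0 /=; ring.
by rewrite sqrrN [p.2 ^+ 2 + _]addrC; field.
Qed.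

(** The divergence identity 2 w (u^2 - v^2) = d/dx (a W) - d/dy (b W): the terms in
    the derivative A of a and b cancel by the Cauchy-Riemann equations, and
    x a - y b = Re (z psi) = u^2 - v^2. *)
Lemma integral_weighted_square_diff (W w : R -> R) r : r < 1 ->
  (forall t, t < 1 -> is_derive t 1 W (w t)) ->
  (forall t, t < 1 -> {for t, continuous w}) -> W r = 0 ->
  (\int[mu2]_(p in [set p | (p.1 ^+ 2 + p.2 ^+ 2 < r)%R])
     (w (p.1 ^+ 2 + p.2 ^+ 2) * (u p ^+ 2 - v p ^+ 2))%:E = 0)%E.
Proof.
move=> r1 dW cw Wr.
pose rho p := p.1 ^+ 2 + p.2 ^+ 2.
have crho p : {for p, continuous rho} by exact: continuous_sqnorm.
have cW t : t < 1 -> {for t, continuous W}.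
  by move=> /dW[dt _]; apply: differentiable_continuous; exact/derivable1_diffP.
have cWr p : rdisk p -> {for p, continuous (W \o rho)}.
  by move=> pD; apply: (continuous_comp (crho p)); apply: cW; rewrite -rdiskE.
have cwr p : rdisk p -> {for p, continuous (w \o rho)}.
  by move=> pD; apply: (continuous_comp (crho p)); apply: cw; rewrite -rdiskE.
pose K1 p := A p * (W (rho p) / 2) + a p * (w (rho p) * p.1).
pose K2 p := A p * (W (rho p) / 2) + b p * (w (rho p) * p.2).
have cK1 p : rdisk p -> {for p, continuous K1}.
  move=> pD; apply: cvgD; apply: cvgM; first exact: cA.
  - by apply: cvgMl; exact: cWr.
  - exact: ca.
  - by apply: cvgM; [exact: cwr|exact: cvg_fst].
have cK2 p : rdisk p -> {for p, continuous K2}.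
  move=> pD; apply: cvgD; apply: cvgM; first exact: cA.
  - by apply: cvgMl; exact: cWr.
  - exact: cb.
  - by apply: cvgM; [exact: cwr|exact: cvg_snd].
have dWr (c x : R) : x ^+ 2 + c < 1 ->
    is_derive x 1 (fun s => W (s ^+ 2 + c) / 2) (w (x ^+ 2 + c) * x).
  move=> x1; have di := is_derive_id x 1.
  have d1 := is_deriveD (is_deriveM di di) (is_derive_cst c x 1).
  have d2 : is_derive (((id : R -> R) * id + cst c) x) 1 W (w (x ^+ 2 + c)) by exact: dW.
  have d3 := is_deriveM (is_derive1_comp d2 d1) (is_derive_cst (2^-1 : R) x 1).
  by apply: (is_derive_eq d3); rewrite /= -![_ *: _]/(_ * _); field.
have i1 : (\int[mu2]_(p in [set p | (p.1 ^+ 2 + p.2 ^+ 2 < r)%R]) (K1 p)%:E = 0)%E.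
  apply: (@integral_subdisk_dx _ (fun p => a p * (W (rho p) / 2))) => //; last first.
    by move=> p pr; rewrite /rho pr Wr mul0r mulr0.
  move=> p pD; have pD' := pD; rewrite rdiskE in pD'.
  apply: (is_derive_eq (is_deriveM (da pD) (dWr _ _ pD'))).
  by rewrite /K1 /= -!surjective_pairing -![_ *: _]/(_ * _) /rho; ring.
have i2 : (\int[mu2]_(p in [set p | (p.1 ^+ 2 + p.2 ^+ 2 < r)%R]) (K2 p)%:E = 0)%E.
  apply: (@integral_subdisk_dy _ (fun p => b p * (W (rho p) / 2))) => //; last first.
    by move=> p pr; rewrite /rho pr Wr mul0r mulr0.
  move=> p pD; have pD' := pD; rewrite rdiskE addrC in pD'.
  have := is_deriveM (db pD) (dWr _ _ pD').
  rewrite /= -!surjective_pairing -![_ *: _]/(_ * _) => D.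
  rewrite /rho (_ : (fun s => _) = (fun s => b (p.1, s)) * (fun s => W (s ^+ 2 + p.1 ^+ 2) / 2)).
    apply: (is_derive_eq D).
    by rewrite /K2 /rho [p.2 ^+ 2 + _]addrC; ring.
  by apply/funext => s /=; rewrite addrC.
have iK1 := integrable_subdisk r1 cK1; have iK2 := integrable_subdisk r1 cK2.
transitivity (\int[mu2]_(p in [set p | (p.1 ^+ 2 + p.2 ^+ 2 < r)%R])
   ((K1 p)%:E - (K2 p)%:E))%E; last first.
  by rewrite integralB// ?i1 ?i2 ?sube0//; exact: measurable_subdisk.
apply: eq_integral => p _; rewrite -EFinB -abE /K1 /K2 /rho; congr EFin; ring.
Qed.

End orthogonality.

(** * Bergman norms and radial integrals *)

Section bergman.
Context {R : realType}.
Implicit Types (e d h s t x y r a b c : R) (p q : R * R) (u v ux uy : R * R -> R).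
Notation mu := (@lebesgue_measure R).
Notation mu2 := ((@lebesgue_measure R) \x (@lebesgue_measure R))%E.

Lemma sqr_cabs (z : R[i]) : cabs z ^+ 2 = complex.Re z ^+ 2 + complex.Im z ^+ 2.
Proof. by case: z => x y; rewrite /cabs /= sqr_sqrtr// addr_ge0 ?sqr_ge0. Qed.

Lemma continuously_differentiable_C1 u :
  continuously_differentiable u -> C1_on_disk u (Dx u) (Dy u).
Proof.
move=> C1 [x y] pD; have [[dx dy] cx cy] := C1 _ pD.
have Ex : (fun h : R => h^-1 *: (u (h *: (1, 0) + (x, y)) - u (x, y))) =
    (fun h : R => h^-1 *: (u (h *: 1 + x, y) - u (x, y))).
  apply/funext => h; congr (_ *: (u _ - _)).
  by rewrite -[LHS]/(h *: 1 + x, h * 0 + y) mulr0 add0r.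
have Ey : (fun h : R => h^-1 *: (u (h *: (0, 1) + (x, y)) - u (x, y))) =
    (fun h : R => h^-1 *: (u (x, h *: 1 + y) - u (x, y))).
  apply/funext => h; congr (_ *: (u _ - _)).
  by rewrite -[LHS]/(h * 0 + x, h *: 1 + y) mulr0 add0r.
have D1 : derivable (fun s => u (s, y)) x 1 by move: dx; rewrite /derivable /= Ex.
have D2 : derivable (fun s => u (x, s)) y 1 by move: dy; rewrite /derivable /= Ey.
split; [apply: (DeriveDef D1)|apply: (DeriveDef D2)|exact: cx|exact: cy].
  by rewrite /Dx /derive /= Ex.
by rewrite /Dy /derive /= Ey.
Qed.

(** Density of dA_alpha with respect to dx dy, as a function of t = |z|^2. *)
Definition bergman_density (alpha t : R) := (alpha + 1) * (1 - t) `^ alpha / pi.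

Context (alpha : R) (alphaN1 : -1 < alpha).

Lemma bergman_density_ge0 t : 0 <= bergman_density alpha t.
Proof.
rewrite /bergman_density divr_ge0 ?pi_ge0// mulr_ge0 ?powR_ge0//.
by move: alphaN1; lra.
Qed.

(** The constant is chosen so that the primitive vanishes at t = r. *)
Lemma is_derive_bergman_primitive r t : t < 1 ->
  is_derive t 1 (fun t => ((1 - r) `^ (alpha + 1) - (1 - t) `^ (alpha + 1)) / pi)
    (bergman_density alpha t).
Proof.
move=> t1; have t0 : 0 < 1 - t by rewrite subr_gt0.
have d1 := is_deriveB (is_derive_cst (1 : R) t 1) (is_derive_id t 1).
have d2 : is_derive ((cst (1 : R) - id) t) 1 ((@powR R) ^~ (alpha + 1))
  ((alpha + 1) * (1 - t) `^ (alpha + 1 - 1)) by exact: is_derive1_powR.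
have d3 := is_deriveB (is_derive_cst ((1 - r) `^ (alpha + 1)) t 1) (is_derive1_comp d2 d1).
have d4 := is_deriveM d3 (is_derive_cst (pi^-1 : R) t 1).
apply: (is_derive_eq d4).
by rewrite /bergman_density addrK /= -![_ *: _]/(_ * _); ring.
Qed.

Lemma continuous_bergman_density t : t < 1 ->
  {for t, continuous (bergman_density alpha)}.
Proof.
move=> t1; have t0 : 0 < 1 - t by rewrite subr_gt0.
apply: cvgMl; apply: cvgMr.
apply: (@continuous_comp _ _ _ (fun t => 1 - t) ((@powR R) ^~ alpha)).
  by apply: cvgB; [exact: cvg_cst|exact: cvg_id].
apply: differentiable_continuous; apply/derivable1_diffP.
by have [] := is_derive1_powR alpha t0.
Qed.

Definition weighted_sqint u : \bar R :=
  (\int[mu2]_(p in rdisk) (u p ^+ 2 * bergman_density alpha (p.1 ^+ 2 + p.2 ^+ 2))%:E)%E.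

Lemma continuous_weighted u p : rdisk p -> {for p, continuous u} ->
  {for p, continuous (fun p => u p ^+ 2 * bergman_density alpha (p.1 ^+ 2 + p.2 ^+ 2))}.
Proof.
move=> pD cu; apply: cvgM; first by rewrite expr2; apply: cvgM.
apply: (@continuous_comp _ _ _ (fun p : R * R => p.1 ^+ 2 + p.2 ^+ 2)).
  exact: continuous_sqnorm.
by apply: continuous_bergman_density; rewrite -rdiskE.
Qed.

Lemma measurable_weighted u : (forall p, rdisk p -> {for p, continuous u}) ->
  measurable_fun (rdisk : set (measurableTypeR R * measurableTypeR R))
    (fun p => (u p ^+ 2 * bergman_density alpha (p.1 ^+ 2 + p.2 ^+ 2))%:E).
Proof.
move=> cu; apply/measurable_EFinP; apply: continuous_measurable_disk => p pD.
exact: continuous_weighted (cu p pD).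
Qed.

(** On each disk |z|^2 < r the two integrals are finite, so the vanishing of the
    integral of the difference equates them; exhausting the unit disk gives the equality
    in [0, +oo]. *)
Lemma weighted_sqint_conjugate u v ux uy :
  C1_on_disk u ux uy -> C1_on_disk v (fun p => - uy p) ux ->
  u (0, 0) = 0 -> v (0, 0) = 0 -> weighted_sqint u = weighted_sqint v.
Proof.
move=> Cu Cv u0 v0.
have cu p (pD : rdisk p) := C1_continuous Cu pD.
have cv p (pD : rdisk p) := C1_continuous Cv pD.
pose D r := [set p : R * R | p.1 ^+ 2 + p.2 ^+ 2 < r].
have subD r : r < 1 -> D r `<=` @rdisk R.
  by move=> r1 p /= pr; rewrite rdiskE; exact: lt_trans r1.
pose f w p := (w p ^+ 2 * bergman_density alpha (p.1 ^+ 2 + p.2 ^+ 2))%:E.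
have eqD r : r < 1 -> (\int[mu2]_(p in D r) f u p = \int[mu2]_(p in D r) f v p)%E.
  move=> r1.
  have iu := integrable_subdisk r1 (fun p pD => continuous_weighted pD (cu p pD)).
  have iv := integrable_subdisk r1 (fun p pD => continuous_weighted pD (cv p pD)).
  have mD := @measurable_subdisk R r.
  have := integral_weighted_square_diff Cu Cv u0 v0 r1
    (@is_derive_bergman_primitive r) continuous_bergman_density.
  rewrite subrr mul0r => /(_ erefl) H.
  have : (\int[mu2]_(p in D r) (f u p - f v p) = 0)%E.
    rewrite -[RHS]H; apply: eq_integral => p _.
    by rewrite -EFinB -mulrBl mulrC.
  rewrite integralB// => /eqP; rewrite sube_eq ?add0e//.
    by move/eqP.
  exact: integrable_fin_num mD _ iu.
pose rn (n : nat) : R := 1 - n.+1%:R^-1.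
have rn1 n : rn n < 1 by rewrite /rn gtrBl invr_gt0.
have rnD : \bigcup_n D (rn n) = @rdisk R.
  apply/seteqP; split=> [p [n _]|p]; first exact: subD.
  rewrite rdiskE -subr_gt0 => p1.
  have := near_infty_natSinv_lt (PosNum p1) => -[n _ /(_ n (leqnn n)) /= H].
  by exists n => //; rewrite /D/= /rn; move: H; rewrite !ltrBrDr addrC.
have cvg w : (forall p, rdisk p -> {for p, continuous w}) ->
    (\int[mu2]_(p in D (rn n)) f w p @[n --> \oo] --> weighted_sqint w)%E.
  move=> cw; rewrite /weighted_sqint -rnD.
  apply: ge0_nondecreasing_set_cvg_integral.
  - move=> n m nm; apply/subsetPset => p /=; rewrite /D/= => /lt_le_trans; apply.
    by rewrite /rn lerB// lef_pV2 ?posrE// ler_nat ltnS.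
  - by move=> n; exact: measurable_subdisk.
  - move=> n; apply: measurable_funS (measurable_weighted cw); last exact: subD.
    exact: measurable_rdisk.
  - by move=> n p _; rewrite lee_fin mulr_ge0 ?sqr_ge0 ?bergman_density_ge0.
have cvgu := cvg _ cu; have cvgv := cvg _ cv.
have uv : (fun n => (\int[mu2]_(p in D (rn n)) f u p)%E) =
    (fun n => (\int[mu2]_(p in D (rn n)) f v p)%E).
  by apply/funext => n; exact: eqD.
rewrite uv in cvgu; exact: cvg_unique cvgu cvgv.
Qed.

Lemma bergman_norm_sqrE (F : R[i] -> R[i]) u v :
  (forall x y, F (x +i* y) = u (x, y) +i* v (x, y)) ->
  (forall p, rdisk p -> {for p, continuous u}) ->
  (forall p, rdisk p -> {for p, continuous v}) ->
  (bergman_norm alpha F ^+ 2 = weighted_sqint u + weighted_sqint v)%E.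
Proof.
move=> FE cu cv.
have E : (int_dA_alpha alpha (fun z => cabs (F z) ^+ 2)%R =
    weighted_sqint u + weighted_sqint v)%E.
  rewrite /weighted_sqint -ge0_integralD//.
  - by apply: eq_integral => -[x y] _; rewrite !sqr_cabs FE /= -EFinD -mulrDl.
  - exact: measurable_rdisk.
  - by move=> p _; rewrite lee_fin mulr_ge0 ?sqr_ge0 ?bergman_density_ge0.
  - exact: measurable_weighted.
  - by move=> p _; rewrite lee_fin mulr_ge0 ?sqr_ge0 ?bergman_density_ge0.
  - exact: measurable_weighted.
have nn w : (0 <= weighted_sqint w)%E.
  by apply: integral_ge0 => p _; rewrite lee_fin mulr_ge0 ?sqr_ge0 ?bergman_density_ge0.
by rewrite /bergman_norm E poweR12_sqrt ?sqr_sqrte// adde_ge0.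
Qed.

Definition radial_sqint u (z : R[i]) : \bar R :=
  (\int[mu]_(x in `[0%R, 1%R[)
    (u (complex.Re z * x, complex.Im z * x) ^+ 2 * (1 - x) `^ (1 + alpha))%:E)%E.

Lemma measurable_radial u (z : R[i]) : cabs z = 1 ->
  (forall p, rdisk p -> {for p, continuous u}) ->
  measurable_fun (`[0%R, 1%R[%classic : set R)
    (fun x => (u (complex.Re z * x, complex.Im z * x) ^+ 2 * (1 - x) `^ (1 + alpha))%:E).
Proof.
move=> z1 cu; apply/measurable_EFinP.
apply: (@measurable_funS _ _ _ _ (`]-1, 1[%classic : set R)) => //.
  by apply: subset_itvr; rewrite bnd_simp; lra.
apply: measurable_funM; last first.
  apply: (measurableT_comp (measurable_powR (1 + alpha))).
  by apply: measurable_funB => //; exact: measurable_id.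
apply: open_continuous_measurable_fun; first exact: interval_open.
move=> x /set_mem /= ; rewrite in_itv/= => x1.
have xD : rdisk (complex.Re z * x, complex.Im z * x).
  rewrite rdiskE/= !exprMn -mulrDl -sqr_cabs z1 expr1n mul1r.
  by rewrite -[x ^+ 2]real_normK ?num_real// expr_lt1// ltr_norml.
have c : {for x, continuous (fun x => u (complex.Re z * x, complex.Im z * x))}.
  apply: (@continuous_comp _ _ _ (fun x => (complex.Re z * x, complex.Im z * x)) u).
    by apply: (cvg_pair (G := nbhs (complex.Re z * x)) (H := nbhs (complex.Im z * x)));
      (apply: cvgM; [exact: cvg_cst|exact: cvg_id]).
  exact: cu.
exact: (cvgM c c).
Qed.

Lemma radial_int_ReIm (F : R[i] -> R[i]) u v (z : R[i]) : cabs z = 1 ->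
  (forall x y, F (x +i* y) = u (x, y) +i* v (x, y)) ->
  (forall p, rdisk p -> {for p, continuous u}) ->
  (forall p, rdisk p -> {for p, continuous v}) ->
  (radial_int alpha F z = radial_sqint u z + radial_sqint v z)%E.
Proof.
move=> z1 FE cu cv; rewrite /radial_sqint -ge0_integralD//.
- apply: eq_integral => x _; rewrite -EFinD -mulrDl sqr_cabs.
  have -> : z * x%:C = (complex.Re z * x) +i* (complex.Im z * x).
    by case: z z1 => a b _; simpc.
  by rewrite FE.
- by move=> x _; rewrite lee_fin mulr_ge0 ?sqr_ge0 ?powR_ge0.
- exact: measurable_radial.
- by move=> x _; rewrite lee_fin mulr_ge0 ?sqr_ge0 ?powR_ge0.
- exact: measurable_radial.
Qed.

(** The analytic inequality is applied to the completion U = u + i v, whose squared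
    norm is twice [weighted_sqint u]; finiteness of the latter puts U in the
    Bergman space. *)
Lemma radial_bound_harmonic (lambda : R) u (z : R[i]) :
  (forall (F : R[i] -> R[i]) (zeta : R[i]),
     in_A2 alpha F -> cabs zeta = 1%R ->
     radial_int alpha F zeta <= lambda%:E * bergman_norm alpha F ^+ 2)%E ->
  real_harmonic u -> u (0, 0) = 0 -> (weighted_sqint u < +oo)%E -> cabs z = 1 ->
  (radial_sqint u z <= (2 * lambda)%:E * weighted_sqint u)%E.
Proof.
move=> hl [/continuously_differentiable_C1 Cu /continuously_differentiable_C1 Cx
  /continuously_differentiable_C1 Cy lap] u0 fin z1.
have [v v0 Cv] := harmonic_conjugate Cx Cy lap.
have cu p (pD : rdisk p) := C1_continuous Cu pD.
have cv p (pD : rdisk p) := C1_continuous Cv pD.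
pose F (z : R[i]) := u (complex.Re z, complex.Im z) +i* v (complex.Re z, complex.Im z).
have FE x y : F (x +i* y) = u (x, y) +i* v (x, y) by [].
have uv := weighted_sqint_conjugate Cu Cv u0 v0.
have nF := bergman_norm_sqrE FE cu cv.
have FA : in_A2 alpha F.
  split; first exact: cauchy_riemann_analytic Cu Cv.
  move: nF; rewrite -uv; case: (bergman_norm alpha F) => [r _| |]; rewrite ?ltry//.
  rewrite expe2 mulyy => E.
  by have := lte_add_pinfty fin fin; rewrite -E ltxx.
have := hl F z FA z1; rewrite nF -uv (radial_int_ReIm z1 FE cu cv).
have rv : (0 <= radial_sqint v z)%E.
  by apply: integral_ge0 => x _; rewrite lee_fin mulr_ge0 ?sqr_ge0 ?powR_ge0.
have -> : (lambda%:E * (weighted_sqint u + weighted_sqint u) = (2 * lambda)%:E * weighted_sqint u)%E.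
  have fu : weighted_sqint u \is a fin_num.
    rewrite ge0_fin_numE//; apply: integral_ge0 => p _.
    by rewrite lee_fin mulr_ge0 ?sqr_ge0 ?bergman_density_ge0.
  by rewrite -(fineK fu) -EFinD -!EFinM; congr EFin; ring.
by apply: le_trans; rewrite leeDl.
Qed.

End bergman.

Local Open Scope ereal_scope.

Theorem theorem1p3 (R : realType) (alpha : R) (halpha : (-1 < alpha)%R)
    (lambda : R)
    (hlambda : forall (F : R[i] -> R[i]) (zeta : R[i]),
        in_A2 alpha F -> cabs zeta = 1%R ->
        radial_int alpha F zeta <= lambda%:E * bergman_norm alpha F ^+ 2)
    (f : R[i] -> R[i]) (hf : in_a2 alpha f) (hf0 : f 0%R = 0%R)
    (zeta : R[i]) (hzeta : cabs zeta = 1%R) :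
  radial_int alpha f zeta <= (2 * lambda)%:E * bergman_norm alpha f ^+ 2.
Proof.
have [[hu hv] fin] := hf.
set u := (fun p : R * R => _) in hu; set v := (fun p : R * R => _) in hv.
have fE x y : f (x +i* y)%C = (u (x, y) +i* v (x, y))%C.
  by rewrite /u /v /=; case: (f _).
have cu p (pD : rdisk p) : {for p, continuous u}.
  by case: hu => /continuously_differentiable_C1 Cu _ _ _; exact: C1_continuous Cu pD.
have cv p (pD : rdisk p) : {for p, continuous v}.
  by case: hv => /continuously_differentiable_C1 Cv _ _ _; exact: C1_continuous Cv pD.
have u0 : u (0, 0)%R = 0%R by rewrite /u /= hf0.
have v0 : v (0, 0)%R = 0%R by rewrite /v /= hf0.
have nE := bergman_norm_sqrE halpha fE cu cv.
have nn w : 0 <= weighted_sqint alpha w.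
  by apply: integral_ge0 => p _; rewrite lee_fin mulr_ge0 ?sqr_ge0 ?bergman_density_ge0.
have : weighted_sqint alpha u + weighted_sqint alpha v < +oo.
  rewrite -nE; move: fin (poweR_ge0 (int_dA_alpha alpha (fun z => cabs (f z) ^+ 2)%R) 2^-1).
  by rewrite -/(bergman_norm alpha f); case: (bergman_norm alpha f) => // r _ _; rewrite -EFin_expe ltry.
move=> sfin.
have fu : weighted_sqint alpha u < +oo by apply: le_lt_trans sfin; rewrite leeDl.
have fv : weighted_sqint alpha v < +oo by apply: le_lt_trans sfin; rewrite leeDr.
rewrite nE (radial_int_ReIm alpha hzeta fE cu cv) muleDr//; last first.
  by rewrite fin_num_adde_defl// ge0_fin_numE.
by apply: leeD; apply: (radial_bound_harmonic halpha hlambda _ _ _ hzeta).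
Qed.
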